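(* Let $\mathcal{M}=\mathcal{M}_1\times\cdots\times\mathcal{M}_b$ where each $\mathcal{M}_i\subset\mathbb{R}^{n_i}$ is closed and non-empty, and let $F:\mathbb{R}^{n_1+\cdots+n_b}\to\mathbb{R}$ be differentiable with level set $\{\boldsymbol{x}: F(\boldsymbol{x})\le\gamma\}$ bounded for every $\gamma\in\mathbb{R}$. Assume that for every $i=1,\dots,b$ the function $F$ has a block-$i$ majorizer $G_i$ and that, moreover, for every $i=1,\dots,b$ and every $\boldsymbol{z}\in\mathcal{M}$, the problem $\min_{\boldsymbol{\xi}\in\mathcal{M}_i}G_i(\boldsymbol{\xi},\boldsymbol{z})$ has a unique global minimizer. Let $\boldsymbol{x}^0\in\mathcal{M}$ and let $\{\boldsymbol{x}^t\}_{t\ge0}\subset\mathcal{M}$ be generated by cyclic block majorization minimization: for $t=0,1,2,\dots$ and, successively, $i=1,\dots,b$, $$\boldsymbol{x}_i^{t+1}\in\operatorname*{argmin}_{\boldsymbol{\xi}\in\mathcal{M}_i}G_i(\boldsymbol{\xi},\boldsymbol{q}_i^t),\qquad \boldsymbol{q}_i^t:=[\boldsymbol{x}_1^{t+1};\dots;\boldsymbol{x}_{i-1}^{t+1};\boldsymbol{x}_i^t;\boldsymbol{x}_{i+1}^t;\dots;\boldsymbol{x}_b^t].$$ Then every limit point of $\{\boldsymbol{x}^t\}_t$ is a stationary point of the problem $\min_{\boldsymbol{x}\in\mathcal{M}}F(\boldsymbol{x})$.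
   Context: Notation: a vector $\boldsymbol{x}\in\mathbb{R}^{n_1+\cdots+n_b}$ is written in blocks $\boldsymbol{x}=[\boldsymbol{x}_1;\dots;\boldsymbol{x}_b]$ with $\boldsymbol{x}_i\in\mathbb{R}^{n_i}$; $\boldsymbol{x}_{i:j}$ denotes the concatenation of blocks $i,\dots,j$ (empty if $i>j$). A limit point of a sequence is the limit of some convergent subsequence. Block-$i$ majorizer: a function $G_i:\mathcal{M}_i\times\mathcal{M}\subset\mathbb{R}^{n_i}\times\mathbb{R}^{n_1+\cdots+n_b}\to\mathbb{R}$ is a block-$i$ majorizer of $F$ if for every $\boldsymbol{x}_i\in\mathcal{M}_i$ and every $\boldsymbol{z}\in\mathcal{M}$: (1) $F(\boldsymbol{z}_{1:i-1},\boldsymbol{x}_i,\boldsymbol{z}_{i+1:b})\le G_i(\boldsymbol{x}_i,\boldsymbol{z})$, with equality attained when $\boldsymbol{x}_i=\boldsymbol{z}_i$; (2) $G_i$ is differentiable (as a function of the ambient Euclidean variables, so that Euclidean gradients make sense), and the two Euclidean gradients $\nabla_{\boldsymbol{z}_i}F(\boldsymbol{z})$ and $\nabla_{\boldsymbol{x}_i}G_i(\boldsymbol{x}_i,\boldsymbol{z})|_{\boldsymbol{x}_i=\boldsymbol{z}_i}$ are equal. Tangent cone: for a non-empty closed set $S\subset\mathbb{R}^n$ and $\boldsymbol{a}\in S$, a vector $\boldsymbol{v}$ is a tangent direction at $\boldsymbol{a}$ for $S$ if there are sequences $\{\boldsymbol{a}_j\}_j\subset S$ and $\{\lambda_j\}_j\subset(0,\infty)$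 with $\boldsymbol{a}_j\to\boldsymbol{a}$, $\lambda_j\to0$ and $(\boldsymbol{a}_j-\boldsymbol{a})/\lambda_j\to\boldsymbol{v}$. The tangent cone $T_S(\boldsymbol{a})$ is the set of all such tangent directions. Stationary point: $\boldsymbol{x}\in\mathcal{M}$ is a stationary point of $\min_{\boldsymbol{x}\in\mathcal{M}}F(\boldsymbol{x})$ if $\langle\nabla F(\boldsymbol{x}),\boldsymbol{v}\rangle\ge0$ for all $\boldsymbol{v}\in T_{\mathcal{M}}(\boldsymbol{x})$, where $\nabla F$ is the Euclidean gradient. *)

(* Defs.v *)
From HB Require Import structures.
From mathcomp Require Import all_boot all_order all_algebra.
From mathcomp Require Import all_classical all_reals all_analysis.

Set Implicit Arguments.
Unset Strict Implicit.
Unset Printing Implicit Defensive.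

Import Order.TTheory GRing.Theory Num.Theory.
Import numFieldNormedType.Exports.
Local Open Scope classical_set_scope.
Local Open Scope ring_scope.

(* Points of R^n are row vectors 'rV[R]_n.  The library norm on them is the sup
   norm; boundedness, limits and differentiability do not depend on the choice
   of norm.  The Euclidean structure enters only through [dot] and [grad]. *)

Definition dot (R : realType) n (u v : 'rV[R]_n) : R :=
  \sum_(k < n) u 0 k * v 0 k.

(* Meaningful at points where f is differentiable. *)
Definition grad (R : realType) n (f : 'rV[R]_n -> R) (a : 'rV[R]_n) :
    'rV[R]_n :=
  \row_(k < n) 'D_(delta_mx 0 k) (f : 'rV[R]_n -> R^o) a.

Definition tangent_cone (R : realType) n (S : set 'rV[R]_n) (a : 'rV[R]_n) :
    set 'rV[R]_n :=
  [set v | exists (s : nat -> 'rV[R]_n) (l : nat -> R),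
    [/\ forall j, S (s j), forall j, 0 < l j,
        s j @[j --> \oo] --> a, l j @[j --> \oo] --> (0 : R) &
        (l j)^-1 *: (s j - a) @[j --> \oo] --> v]].

Definition stationary_point (R : realType) n (S : set 'rV[R]_n)
    (F : 'rV[R]_n -> R) (x : 'rV[R]_n) : Prop :=
  S x /\ forall v, tangent_cone S x v -> 0 <= dot (grad F x) v.

Definition seq_limit_point (R : realType) n (x : nat -> 'rV[R]_n) (a : 'rV[R]_n) :
    Prop :=
  exists s : nat -> nat,
    {homo s : j k / (j < k)%N} /\ x (s j) @[j --> \oo] --> a.

Definition argmin (R : realType) n (S : set 'rV[R]_n) (g : 'rV[R]_n -> R) :
    set 'rV[R]_n :=
  [set x | S x /\ forall y, S y -> g x <= g y].

Section Blocks.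
Variables (R : realType) (b : nat) (n : 'I_b -> nat).

(* R^(n_1 + ... + n_b); the i-th block of x is [submxrow x i], and [\mxrow_j]
   concatenates blocks.  Blocks are indexed from 0. *)
Local Notation vec := 'rV[R]_(\sum_i n i).

Definition block_product (M : forall i, set 'rV[R]_(n i)) : set vec :=
  [set x | forall i, M i (submxrow x i)].

Definition set_block (z : vec) (i : 'I_b) (xi : 'rV[R]_(n i)) : vec :=
  \mxrow_(j < b) @dfwith _ (fun k => 'rV_(n k)) (submxrow z) i xi j.

(* G is total on the ambient space so that its Euclidean gradients make sense;
   differentiability is joint in both arguments and is required only at the
   points of M i * block_product M. *)
Record block_majorizer (M : forall i, set 'rV[R]_(n i)) (F : vec -> R)
    (i : 'I_b) (G : 'rV[R]_(n i) -> vec -> R) : Prop := BlockMajorizer {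
  majorizer_ge : forall xi z, M i xi -> block_product M z ->
    F (set_block z xi) <= G xi z ;
  majorizer_eq : forall xi z, M i xi -> block_product M z ->
    xi = submxrow z i -> F (set_block z xi) = G xi z ;
  majorizer_differentiable : forall xi z, M i xi -> block_product M z ->
    differentiable ((fun p => G p.1 p.2) : 'rV[R]_(n i) * vec -> R^o) (xi, z) ;
  majorizer_grad : forall z, block_product M z ->
    grad (fun xi => F (set_block z xi)) (submxrow z i) =
    grad (fun xi => G xi z) (submxrow z i)
}.

(* The point q_i^t: blocks before i are already updated. *)
Definition cyclic_iterate (x : nat -> vec) (t : nat) (i : 'I_b) : vec :=
  \mxrow_(j < b) (if (j < i)%N then submxrow (x t.+1) j else submxrow (x t) j).

Definition cyclic_bmm (M : forall i, set 'rV[R]_(n i))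
    (G : forall i, 'rV[R]_(n i) -> vec -> R) (x : nat -> vec) : Prop :=
  forall t i,
    argmin (M i) (fun xi => G i xi (cyclic_iterate x t i))
      (submxrow (x t.+1) i).

End Blocks.

(* Main.v *)
Require Import Defs.
From HB Require Import structures.
From mathcomp Require Import all_boot all_order all_algebra.
From mathcomp Require Import all_classical all_reals all_analysis.
From mathcomp Require Import lra.

Set Implicit Arguments.
Unset Strict Implicit.
Unset Printing Implicit Defensive.

Import Order.TTheory GRing.Theory Num.Theory.
Import numFieldNormedType.Exports.
Local Open Scope classical_set_scope.
Local Open Scope ring_scope.

(** Why the limit points are stationary.  Updating one block does not increase
[F]: the majorizer lies above [F], touches it at the current point, and is
minimized by the update.  Hence [F] decreases along the intermediate points
q_0, ..., q_b of every sweep, where q_i is the point before block [i] is updated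
and q_b is the next iterate.  If a subsequence of the iterates tends to [a],
then, [F] being continuous, every value of [F] along the algorithm is at least
[F a].

Along that subsequence all the intermediate points tend to [a], by induction on
the block index (lemma [limit_point_argmin]).  Suppose q_i tends to [a].  The
updated blocks lie in a compact set, because sublevel sets of [F] are bounded,
so they converge to the block a_i as soon as a_i is their only cluster value.
Let [y] be a cluster value.  By continuity of [G_i], [y] minimizes [G_i(., a)]
over [M i].  Moreover [G_i(y, a) >= F a], as the majorizers dominate the values
of [F] after the update, and [F a = G_i(a_i, a)].  So a_i is a minimizer as
well, and the minimizer is unique: [y = a_i] (lemma [majorizer_argmin_cvg]).

Therefore each a_i minimizes [G_i(., a)] over [M i], and the first-order
condition holds on the tangent cone of [M i] ([argmin_tangent]).  The gradient
of [G_i(., a)] at a_i is block [i] of the gradient of [F] at [a]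
([submxrow_grad]), tangent directions of a product are blockwise tangent
([tangent_cone_block]), and the inner product is the sum of the blockwise inner
products ([dot_blocks]). *)

(** * Convergence of vectors *)

Lemma cvg_mx (R : realType) m n (T : Type) (F : set_system T)
    {FF : Filter F} (u : T -> 'M[R]_(m, n)) (l : 'M[R]_(m, n)) :
  (forall i j, u t i j @[t --> F] --> l i j) -> u @ F --> l.
Proof.
move=> cv A [B nbhsB sBA]; rewrite /= nbhs_filterE.
apply: (@filterS _ F _ (fun t => forall i j, B i j (u t i j))).
  by move=> t Bt; apply: sBA.
apply: (@filter_forall _ _ (fun i t => forall j, B i j (u t i j))) => i.
apply: filter_forall => j; exact: (cv i j _ (nbhsB i j)).
Qed.

(** A map with values in a compact set converges along [F] to [l] when [l] is
its only possible limit along the proper filters finer than [F].  Finer filters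
play the role of subsequences. *)
Lemma cvg_ultra_unique (T : Type) (X : topologicalType) (F : set_system T)
    {FF : Filter F} (u : T -> X) (K : set X) (l : X) :
  compact K -> (forall t, K (u t)) ->
  (forall U : set_system T, ProperFilter U -> F `<=` U ->
     forall y, u @ U --> y -> y = l) ->
  u @ F --> l.
Proof.
move=> cK uK uniq A nA; rewrite /= nbhs_filterE; apply: contrapT => nFA.
(* If the map leaves the neighborhood A of l frequently along F, some
   ultrafilter finer than F contains the complement of its preimage. *)
pose W := within (~` (u @^-1` A)) F.
have WF : ProperFilter W.
  split; last exact: within_filter.
  move=> W0; apply: nFA; apply: (@filterS _ F _ _ _ _ W0) => t /= tA.
  exact: contrapT.
have [U [UU WU]] := ultraFilterLemma WF.
have UP : ProperFilter U by exact: ultra_proper.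
have [y [_ uy]] : K `&` [set p | u @ U --> p] !=set0.
  have := cK; rewrite compact_ultra; apply.
    split=> [|G PG uG]; first exact: fmap_proper_filter.
    apply/seteqP; split=> // C GC.
    have [//|UnC] := in_ultra_setVsetC (u @^-1` C) UU.
    have GnC : G (~` C) by apply: uG.
    by have [t []] := filter_ex (filterI GC GnC).
  exact: (@filterE _ U _ (u @^-1` K) uK).
have FU : F `<=` U by move=> B FB; apply: WU; apply: (@filterS _ F _ B _ _ FB).
have yl := uniq U UP FU y uy; subst y.
have UA : U (u @^-1` A) by apply: uy.
have UnA : U (~` (u @^-1` A)) by apply: WU; apply: (@filterE _ F).
by have [t []] := filter_ex (filterI UA UnA).
Qed.

(** * First-order condition on the tangent cone *)

Lemma dot_grad (R : realType) n (f : 'rV[R]_n -> R) (a v : 'rV[R]_n) :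
  differentiable (f : 'rV[R]_n -> R^o) a ->
  dot (grad f a) v = 'd (f : 'rV[R]_n -> R^o) a v.
Proof.
move=> df; rewrite {2}(matrix_sum_delta v) big_ord1 linear_sum.
by apply: eq_bigr => k _; rewrite mxE deriveE // linearZ /= mulrC.
Qed.

Lemma argmin_tangent (R : realType) n (S : set 'rV[R]_n) (g : 'rV[R]_n -> R)
    (a v : 'rV[R]_n) :
  differentiable (g : 'rV[R]_n -> R^o) a -> argmin S g a ->
  tangent_cone S a v -> 0 <= dot (grad g a) v.
Proof.
move=> dg [Sa mina] [s [l [Ss l0 sa l_0 wv]]]; rewrite dot_grad//.
set dga := 'd (g : 'rV[R]_n -> R^o) a.
pose w j := (l j)^-1 *: (s j - a).
have cdg : dga (w j) @[j --> \oo] --> dga v.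
  by apply: (cvg_comp w dga wv); apply: diff_continuous.
(* For j large, g (s j) - g a differs from dga (s j - a) by at most
   e * |s j - a|; it is nonnegative by minimality, and dividing by l j turns
   s j - a into w j. *)
have key (e : R) : 0 < e -> 0 <= dga v + e * `|v|.
  move=> e0.
  have cvr : dga (w j) + e * `|w j| @[j --> \oo] --> dga v + e * `|v|.
    apply: cvgD => //; apply: cvgM; first exact: cvg_cst.
    exact: cvg_norm.
  apply: (cvgr_to_ge cvr).
  have /eqaddoP/(_ _ e0) := diff_locally dg => small.
  have sa0 : (fun j => s j - a) @ \oo --> (0 : 'rV[R]_n).
    by rewrite -(subrr a); apply: cvgB sa (cvg_cst a).
  have small_s : \forall j \near \oo,
      `|g (s j - a + a) - (g a + dga (s j - a))| <= e * `|s j - a|.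
    exact: (sa0 _ small).
  apply: filterS small_s => j.
  rewrite subrK => h.
  have gs : g a <= g (s j) by exact: mina.
  have ub : 0 <= dga (s j - a) + e * `|s j - a|.
    by move: h; rewrite ler_norml => /andP[_]; lra.
  have li : 0 <= (l j)^-1 by rewrite invr_ge0 ltW.
  rewrite /w linearZ normrZ (ger0_norm li) mulrCA -mulrDr.
  exact: mulr_ge0.
apply/ler_addgt0Pr => e e0.
have v1 : 0 < `|v| + 1 by rewrite ltr_wpDl.
apply: le_trans (key (e / (`|v| + 1)) (divr_gt0 e0 v1)) _.
by rewrite lerD2l -mulrA ler_piMr ?(ltW e0)// ler_pdivrMl// mulr1 lerDl.
Qed.

(** * Block decomposition *)

Section Blocks.
Variables (R : realType) (b : nat) (n : 'I_b -> nat).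
Local Notation vec := 'rV[R]_(\sum_i n i).

Lemma submxrow_set_block (z : vec) i xi j :
  submxrow (@set_block R b n z i xi) j =
  @dfwith _ (fun k => 'rV_(n k)) (submxrow z) i xi j.
Proof. by rewrite mxrowK. Qed.

Lemma set_block_id (z : vec) i : set_block z (submxrow z i) = z.
Proof. by apply/mxrowP => j; rewrite mxrowK; case: dfwithP. Qed.

Lemma dot_blocks (u v : vec) :
  dot u v = \sum_i dot (submxrow u i) (submxrow v i).
Proof.
have dotE m (p q : 'rV[R]_m) : dot p q = (p *m q^T) 0 0.
  by rewrite mxE; apply: eq_bigr => k _; rewrite mxE.
rewrite dotE -{1}(submxrowK u) -{1}(submxrowK v) tr_mxrow mul_mxrow_mxcol.
by rewrite summxE; apply: eq_bigr => i _; rewrite dotE.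
Qed.

(** Both sides are made of the same directional derivatives of [F], so no
differentiability is needed. *)
Lemma submxrow_grad (F : vec -> R) (z : vec) i :
  submxrow (grad F z) i =
  grad (fun xi => F (set_block z xi)) (submxrow z i).
Proof.
apply/rowP => k; rewrite !mxE /derive set_block_id.
have Rank_eq j (m : 'I_(n j)) :
    (tagnat.Rank j m == tagnat.Rank i k) =
    (Tagged (fun j => 'I_(n j)) m == Tagged (fun j => 'I_(n j)) k).
  by rewrite /tagnat.Rank (inj_eq tagnat.rank_inj).
have E (h : R) : h *: delta_mx 0 (tagnat.Rank i k) + z =
   @set_block R b n z i (h *: delta_mx 0 k + submxrow z i).
  apply/mxrowP => j; rewrite submxrow_set_block; case: dfwithP => [|{}j ij].
    by apply/rowP => m; rewrite !mxE Rank_eq eqxx /= eq_Tagged.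
  by apply/rowP => m; rewrite !mxE Rank_eq -tag_eqE /tag_eq /=;
    rewrite eq_sym (negbTE ij) mulr0 add0r.
apply: (congr1 (fun f : R -> R^o => lim (f @ 0^'))).
by apply/funext => h /=; rewrite E.
Qed.

Lemma cvg_blocks (T : Type) (F : set_system T) {FF : Filter F}
    (u : T -> vec) (l : vec) :
  (forall i, submxrow (u t) i @[t --> F] --> submxrow l i) -> u @ F --> l.
Proof.
move=> cv; apply: (@cvg_mx R 1 _ _ _ _) => i j; rewrite ord1.
have uE t : u t 0 j = submxrow (u t) (tagnat.sig1 j) 0 (tagnat.sig2 j).
  by rewrite mxE tagnat.sig2K.
have lE : l 0 j = submxrow l (tagnat.sig1 j) 0 (tagnat.sig2 j).
  by rewrite mxE tagnat.sig2K.
rewrite lE; under eq_fun do rewrite uE.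
apply: (cvg_comp _ (fun A : 'rV[R]__ => A 0 (tagnat.sig2 j)) (cv _)).
exact: coord_continuous.
Qed.

Lemma submxrow_continuous i : continuous (fun z : vec => submxrow z i).
Proof.
move=> z; apply: (@cvg_mx R 1 _ _ _ (nbhs_filter z)) => k j.
have E : (fun t : vec => submxrow t i k j) = fun t => t k (tagnat.Rank i j).
  by apply/funext => t; rewrite mxE.
rewrite -[submxrow z i k j]/((fun t : vec => submxrow t i k j) z) E.
exact: coord_continuous.
Qed.
End Blocks.

(** * Block majorizers *)

Section Majorizers.
Variables (R : realType) (b : nat) (n : 'I_b -> nat).
Local Notation vec := 'rV[R]_(\sum_i n i).
Variables (M : forall i, set 'rV[R]_(n i)) (F : vec -> R).
Arguments M : clear implicits.
Hypothesis M_closed : forall i, closed (M i).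

Lemma closed_block_product : closed (block_product M).
Proof.
move=> a cla i; apply: M_closed => B nB.
have [z [Mz Bz]] := cla _ (@submxrow_continuous R b n i a B nB).
by exists (submxrow z i); split => //; apply: Mz.
Qed.

Lemma majorizer_self i G z : block_majorizer M F G -> block_product M z ->
  G (submxrow z i) z = F z.
Proof.
by move=> GF Mz; rewrite -(majorizer_eq GF) ?set_block_id//; apply: Mz.
Qed.

Lemma majorizer_cvg i (G : 'rV[R]_(n i) -> vec -> R) (T : Type)
    (U : set_system T) {UF : Filter U}
    (u : T -> 'rV[R]_(n i)) (q : T -> vec) y a :
  block_majorizer M F G -> M i y -> block_product M a ->
  u @ U --> y -> q @ U --> a -> G (u t) (q t) @[t --> U] --> G y a.
Proof.
move=> GF My Ma uy qa.
have dG := majorizer_differentiable GF My Ma.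
exact: (cvg_comp (fun t => (u t, q t)) (fun p => G p.1 p.2 : R^o)
  (cvg_pair uy qa) (differentiable_continuous dG)).
Qed.

(** Minimizers of [G(., q)] over the closed set [M i] pass to the limit. *)
Lemma argmin_cvg i (G : 'rV[R]_(n i) -> vec -> R) (T : Type)
    (U : set_system T) {UF : ProperFilter U}
    (u : T -> 'rV[R]_(n i)) (q : T -> vec) y a :
  block_majorizer M F G -> block_product M a ->
  u @ U --> y -> q @ U --> a ->
  (forall t, argmin (M i) (G^~ (q t)) (u t)) -> argmin (M i) (G^~ a) y.
Proof.
move=> GF Ma uy qa minu.
have Mu : \forall t \near U, M i (u t) by apply: filterE => t; case: (minu t).
have My : M i y by exact: (closed_cvg (M i) (@M_closed i) Mu y uy).
split=> // xi Mxi.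
have cy : G (u t) (q t) @[t --> U] --> G y a by exact: majorizer_cvg.
have cxi : G xi (q t) @[t --> U] --> G xi a.
  exact: (majorizer_cvg GF Mxi Ma (cvg_cst xi) qa).
rewrite -subr_ge0; apply: (cvgr_to_ge (cvgB cxi cy)).
by apply: filterE => t; rewrite subr_ge0; apply: (minu t).2.
Qed.

(** If [q] tends to [a] and the updates [u] of block [i] at [q] stay in a
compact set and never bring [F] below [F a], then [u] tends to block [i] of [a],
provided the minimizer of [G(., a)] over [M i] is unique. *)
Lemma majorizer_argmin_cvg i (G : 'rV[R]_(n i) -> vec -> R) (T : Type)
    (U : set_system T) {UF : ProperFilter U}
    (K : set 'rV[R]_(n i)) (u : T -> 'rV[R]_(n i)) (q : T -> vec) a :
  block_majorizer M F G -> block_product M a ->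
  (forall xi xi', argmin (M i) (G^~ a) xi -> argmin (M i) (G^~ a) xi' ->
    xi = xi') ->
  compact K -> (forall t, K (u t)) -> (forall t, block_product M (q t)) ->
  (forall t, argmin (M i) (G^~ (q t)) (u t)) ->
  (forall t, F a <= F (set_block (q t) (u t))) ->
  q @ U --> a -> u @ U --> submxrow a i.
Proof.
move=> GF Ma uniq cK uK Mq minu Fa qa.
apply: (cvg_ultra_unique cK uK) => W WP UW y uy.
have qaW : q @ W --> a by move=> A /qa; apply: UW.
have miny : argmin (M i) (G^~ a) y by exact: (argmin_cvg GF Ma uy qaW minu).
(* Block i of a is a minimizer too: G(a_i, a) = F a <= G(y, a). *)
apply: uniq => //; split; first exact: Ma.
move=> xi Mxi; apply: le_trans (miny.2 _ Mxi).
rewrite (majorizer_self GF Ma).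
have Gy : G (u t) (q t) @[t --> W] --> G y a.
  exact: (majorizer_cvg GF miny.1 Ma uy qaW).
apply: (cvgr_to_ge Gy).
apply: filterE => t; apply: le_trans (Fa t) _.
by apply: (majorizer_ge GF) => //; have [] := minu t.
Qed.

(** * Cyclic block majorization minimization *)

Variables (G : forall i, 'rV[R]_(n i) -> vec -> R) (x : nat -> vec).
Arguments G : clear implicits.
Hypotheses (G_major : forall i, block_majorizer M F (G i))
  (x0_in : block_product M (x 0%N)) (x_bmm : cyclic_bmm M G x).

(** The point reached within sweep [t] once the blocks before [k] are updated.
It extends [cyclic_iterate], whose index is an ordinal, to the end of the sweep
[k = b]; the two are convertible when [k] is the value of an ordinal. *)
Definition partial_iterate t (k : nat) : vec :=
  \mxrow_(j < b) (if (j < k)%N then submxrow (x t.+1) j else submxrow (x t) j).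

Lemma partial_iterate0 t : partial_iterate t 0%N = x t.
Proof. by apply/mxrowP => j; rewrite mxrowK. Qed.

Lemma partial_iterate_last t : partial_iterate t b = x t.+1.
Proof. by apply/mxrowP => j; rewrite mxrowK /= ltn_ord. Qed.

Lemma partial_iterateS t (i : 'I_b) :
  partial_iterate t i.+1 =
  set_block (partial_iterate t i) (submxrow (x t.+1) i).
Proof.
apply/mxrowP => j; rewrite submxrow_set_block mxrowK.
case: dfwithP => [|{}j ij]; first by rewrite /= ltnS leqnn.
rewrite mxrowK /= ltnS leq_eqVlt -[(j : nat) == i]/(j == i).
by rewrite eq_sym (negbTE ij).
Qed.

Lemma iterate_in t : block_product M (x t).
Proof. by case: t => // t i; have [] := x_bmm t i. Qed.

Lemma partial_iterate_in t k : block_product M (partial_iterate t k).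
Proof. by move=> j; rewrite mxrowK; case: ifP => _; apply: iterate_in. Qed.

Lemma partial_iterate_step t (i : 'I_b) :
  F (partial_iterate t i.+1) <= F (partial_iterate t i).
Proof.
have Mq := partial_iterate_in t i; have [Mx minx] := x_bmm t i.
rewrite partial_iterateS -(majorizer_self (G_major i) Mq).
apply: le_trans (majorizer_ge (G_major i) Mx Mq) _.
exact/minx/Mq.
Qed.

Lemma partial_iterate_mono t k m : (k <= m <= b)%N ->
  F (partial_iterate t m) <= F (partial_iterate t k).
Proof.
case/andP; elim: m => [|m IH]; first by rewrite leqn0 => /eqP->.
rewrite leq_eqVlt => /orP[/eqP->//|km mb].
by apply: le_trans (partial_iterate_step t (Ordinal mb)) (IH km (ltnW mb)).
Qed.

Lemma iterate_mono : {homo F \o x : s t / (s <= t)%N >-> t <= s}.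
Proof.
apply: homo_leq => //= [? ? ? ? /le_trans|t]; first by apply.
rewrite -partial_iterate_last -[in leRHS]partial_iterate0.
by apply: partial_iterate_mono; rewrite leqnn.
Qed.

Hypothesis F_cont : continuous F.
Hypothesis F_level : forall gamma : R, bounded_set [set a | F a <= gamma].
Hypothesis G_uniq : forall i z, block_product M z ->
    exists! xi, argmin (M i) (fun xi => G i xi z) xi.

Lemma sublevel_compact gamma : compact [set a | F a <= gamma].
Proof.
apply: bounded_closed_compact => //.
apply: (@preimage_closed _ _ F [set r | r <= gamma]) => [a _|].
  exact: F_cont.
exact: closed_le.
Qed.

(** At a limit point, each block minimizes its own majorizer. *)
Lemma limit_point_argmin a : seq_limit_point x a ->
  block_product M a /\
  forall i, argmin (M i) ((G i)^~ a) (submxrow a i).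
Proof.
move=> [s [s_incr xa]].
have Ma : block_product M a.
  have Mx : \forall j \near \oo, block_product M (x (s j)).
    by apply: filterE => j; apply: iterate_in.
  exact: (closed_cvg _ closed_block_product Mx a xa).
have s_ge j : (j <= s j)%N.
  by elim: j => // j IH; apply: leq_ltn_trans IH (s_incr _ _ _).
have Fa t : F a <= F (x t).
  have Fxa : F (x (s j)) @[j --> \oo] --> F a.
    exact: (cvg_comp (x \o s) F xa (@F_cont a)).
  apply: (cvgr_to_le Fxa).
  exists t => // j /= tj; apply: iterate_mono.
  exact: leq_trans tj (s_ge j).
pose K i := (fun z : vec => submxrow z i) @` [set z | F z <= F (x 0%N)].
have cK i : compact (K i).
  apply: continuous_compact; last exact: sublevel_compact.
  by apply: continuous_subspaceT => z; exact: submxrow_continuous.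
have step (i : 'I_b) : partial_iterate (s j) i @[j --> \oo] --> a ->
    submxrow (x (s j).+1) i @[j --> \oo] --> submxrow a i.
  apply: (majorizer_argmin_cvg (G_major i) Ma _ (cK i)).
  - move=> xi xi' mxi mxi'; have [w [_ uw]] := G_uniq i Ma.
    by rewrite -(uw _ mxi) -(uw _ mxi').
  - by move=> j; exists (x (s j).+1) => //; apply: iterate_mono.
  - by move=> j; exact: partial_iterate_in.
  - by move=> j; exact: x_bmm.
  - move=> j; rewrite -partial_iterateS; apply: le_trans (Fa (s j).+1) _.
    by rewrite -partial_iterate_last partial_iterate_mono// leqnn andbT.
have qa k : (k <= b)%N -> partial_iterate (s j) k @[j --> \oo] --> a.
  elim: k => [_|k IH kb].
    suff -> : (fun j => partial_iterate (s j) 0%N) = (fun j => x (s j)) by [].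
    by apply/funext => j; exact: partial_iterate0.
  have {}IH := IH (ltnW kb); have xk := step (Ordinal kb) IH.
  apply: cvg_blocks => i; have [ik|ik] := eqVneq (Ordinal kb) i.
    rewrite -{}ik.
    suff -> : (fun j => submxrow (partial_iterate (s j) k.+1) (Ordinal kb)) =
        (fun j => submxrow (x (s j).+1) (Ordinal kb)) by [].
    apply/funext => j; rewrite (partial_iterateS _ (Ordinal kb)).
    by rewrite submxrow_set_block dfwithin.
  suff -> : (fun j => submxrow (partial_iterate (s j) k.+1) i) =
      (fun j => submxrow (partial_iterate (s j) k) i).
    exact: (cvg_comp _ _ IH (@submxrow_continuous R b n i a)).
  apply/funext => j; rewrite (partial_iterateS _ (Ordinal kb)).
  by rewrite submxrow_set_block dfwithout.
split=> // i; have qi := qa i (ltnW (ltn_ord i)).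
by apply: (argmin_cvg (G_major i) Ma (step i qi) qi) => j; exact: x_bmm.
Qed.

End Majorizers.

Lemma tangent_cone_block (R : realType) (b : nat) (n : 'I_b -> nat)
    (M : forall i, set 'rV[R]_(n i)) a v i :
  tangent_cone (block_product M) a v ->
  tangent_cone (M i) (submxrow a i) (submxrow v i).
Proof.
have sc z := @submxrow_continuous R b n i z.
move=> [s [l [Ms l0 sa la wv]]].
exists (fun j => submxrow (s j) i), l; split => //.
- by move=> j; apply: Ms.
- exact: cvg_comp sa (sc a).
- have := cvg_comp _ _ wv (sc v).
  (* The extraction of a block commutes with the linear operations. *)
  apply: cvg_trans; apply: near_eq_cvg; apply: nearW => j /=.
  by apply/rowP => k; rewrite !mxE.
Qed.

Theorem theorem2 (R : realType) (b : nat) (n : 'I_b -> nat)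
  (M : forall i : 'I_b, set 'rV[R]_(n i))
  (F : 'rV[R]_(\sum_i n i) -> R)
  (G : forall i : 'I_b, 'rV[R]_(n i) -> 'rV[R]_(\sum_i n i) -> R)
  (x : nat -> 'rV[R]_(\sum_i n i))
  (M_closed : forall i, closed (M i))
  (M_nonempty : forall i, M i !=set0)
  (F_diff : forall a, differentiable (F : 'rV[R]_(\sum_i n i) -> R^o) a)
  (F_level : forall gamma : R, bounded_set [set a | F a <= gamma])
  (G_major : forall i, block_majorizer M F (G i))
  (G_uniq : forall i z, block_product M z ->
    exists! xi, argmin (M i) (fun xi => G i xi z) xi)
  (x0_in : block_product M (x 0%N))
  (x_bmm : cyclic_bmm M G x) :
  forall a, seq_limit_point x a -> stationary_point (block_product M) F a.
Proof.
move=> a xa.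
have F_cont : continuous F.
  by move=> z; exact: (differentiable_continuous (F_diff z)).
have [Ma mina] := limit_point_argmin M_closed G_major x0_in x_bmm F_cont
  F_level G_uniq xa.
split=> // v Tv; rewrite dot_blocks; apply: sumr_ge0 => i _.
rewrite submxrow_grad (majorizer_grad (G_major i) Ma).
apply: (argmin_tangent _ (mina i) (tangent_cone_block i Tv)).
have dG := majorizer_differentiable (G_major i) (Ma i) Ma.
apply: (differentiable_comp (f := fun xi => (xi, a)) _ dG).
exact: differentiable_pair.
Qed.
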